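(* Let $X$ be a Banach sequence space with $N$-dimensional sections $X_N=\operatorname{span}\{e_1,\dots,e_N\}\subseteq X$, $N\in\mathbb{N}$. If the spaces $X_N$ $(N\in\mathbb{N})$ are uniformly complemented in some $L_\infty(\mu)$, then they are uniformly isomorphic to $\ell_\infty^N$, i.e. $\sup_N d(X_N,\ell_\infty^N)<\infty$, where $d$ is the Banach-Mazur distance.
   Context: $\mathbb{K}$ denotes the real or complex scalars. A Banach sequence space is a Banach space $X\subseteq\mathbb{K}^{\mathbb{N}}$ of scalar sequences such that $\ell_1\subseteq X\subseteq\ell_\infty$ with norm-one inclusions, and such that if $x\in\mathbb{K}^{\mathbb{N}}$ and $y\in X$ satisfy $|x_n|\le|y_n|$ for all $n$, then $x\in X$ and $\|x\|\le\|y\|$. $\{e_n\}_n$ are the canonical vectors, and $X_N$ carries the norm of $X$. $\ell_\infty^N$ is $\mathbb{K}^N$ with the sup norm. A family $\{X_N\}_N$ with $\dim X_N=N$ is $K$-uniformly complemented in a Banach space $Z$ if for each $N$ there are continuous linear maps $i_N:X_N\to Z$ and $q_N:Z\to X_N$ with $q_N\circ i_N=\mathrm{id}_{X_N}$ and $\|i_N\|\,\|q_N\|\le K$; it is uniformly complemented in $Z$ if this holds for some $K$. *)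

(* Defs.v *)
From HB Require Import structures.
From mathcomp Require Import all_boot all_order all_algebra generic_quotient ring_quotient.
From mathcomp Require Import all_classical all_reals all_analysis.
From mathcomp Require Import ess_sup_inf measurable_realfun complex.

Set Implicit Arguments.
Unset Strict Implicit.
Unset Printing Implicit Defensive.

Import Order.TTheory GRing.Theory Num.Theory.
Import numFieldNormedType.Exports.

Local Open Scope classical_set_scope.
Local Open Scope ring_scope.

Variant scalar_kind := RealScalars | ComplexScalars.

Definition scalar_field (R : realType) (s : scalar_kind) : numFieldType :=
  match s with RealScalars => R | ComplexScalars => R[i] end.

Definition re_part (R : realType) (s : scalar_kind) : scalar_field R s -> R :=
  match s with RealScalars => id | ComplexScalars => @complex.Re R end.

Definition im_part (R : realType) (s : scalar_kind) : scalar_field R s -> R :=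
  match s with RealScalars => fun=> 0 | ComplexScalars => @complex.Im R end.

Definition of_real (R : realType) (s : scalar_kind) : R -> scalar_field R s :=
  match s with RealScalars => id | ComplexScalars => fun x => x%:C%C end.
Arguments of_real {R} s.

Section scalar_parts.
Variable R : realType.

Lemma re_part0 s : re_part (0 : scalar_field R s) = 0.
Proof. by case: s. Qed.

Lemma im_part0 s : im_part (0 : scalar_field R s) = 0.
Proof. by case: s. Qed.

Lemma of_real0 s : of_real s (0 : R) = 0.
Proof. by case: s. Qed.

Lemma of_real1 s : of_real s (1 : R) = 1.
Proof. by case: s. Qed.

Lemma re_partD s : {morph @re_part R s : x y / x + y}.
Proof. by case: s => //= -[a b] [c d]. Qed.

Lemma im_partD s : {morph @im_part R s : x y / x + y}.
Proof. by case: s => //= [x y|[a b] [c d]//]; rewrite addr0. Qed.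

Lemma re_partM s (x y : scalar_field R s) :
  re_part (x * y) = re_part x * re_part y - im_part x * im_part y.
Proof. by case: s x y => /= [x y|[a b] [c d]//]; rewrite mul0r subr0. Qed.

Lemma im_partM s (x y : scalar_field R s) :
  im_part (x * y) = re_part x * im_part y + im_part x * re_part y.
Proof. by case: s x y => /= [x y|[a b] [c d]//]; rewrite mulr0 mul0r addr0. Qed.

Lemma of_realD s : {morph @of_real R s : x y / x + y}.
Proof. by case: s => //= x y; rewrite -rmorphD. Qed.

Lemma of_realM s : {morph @of_real R s : x y / x * y}.
Proof. by case: s => //= x y; rewrite -rmorphM. Qed.

Lemma ler_of_real s : {mono @of_real R s : x y / x <= y}.
Proof. by case: s => //= x y; rewrite lecR. Qed.

Lemma re_partK s : cancel (@of_real R s) (@re_part R s).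
Proof. by case: s. Qed.

Lemma of_real_norm s (x : scalar_field R s) : of_real s (re_part `|x|) = `|x|.
Proof. by case: s x => //= x; rewrite normc_def. Qed.

End scalar_parts.

(** Norms in a [normedModType K] take values in [K]; [rnorm] is the same
    (nonnegative) number seen in [R]. *)
Definition rnorm (R : realType) (s : scalar_kind)
  (E : normedModType (scalar_field R s)) (x : E) : R := re_part `|x|.

Section Linfty.
Variables (R : realType) (s : scalar_kind).
Local Notation K := (scalar_field R s).
Variables (d : measure_display) (T : measurableType d).
Variable mu : {measure set T -> \bar R}.

(** Both coordinates are measured, so that a complex-valued function is
    measurable iff its real and imaginary parts are. *)
Definition smeasurable (f : T -> K) :=
  measurable_fun [set: T] (fun t => re_part (f t)) /\
  measurable_fun [set: T] (fun t => im_part (f t)).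

Definition modulus (f : T -> K) : T -> R := fun t => re_part `|f t|.

Definition Linfty_pred : {pred T -> K} :=
  mem [set f | smeasurable f /\ finite_norm mu +oo (modulus f)].

Definition linf (f : T -> K) : R := fine ('N[mu]_+oo [EFin \o modulus f]).

Lemma modulus_ge0 f t : 0 <= modulus f t.
Proof. by rewrite -(ler_of_real s) of_real_norm of_real0. Qed.

Lemma modulusD f g t : modulus (f + g) t <= modulus f t + modulus g t.
Proof. by rewrite -(ler_of_real s) of_realD !of_real_norm ler_normD. Qed.

Lemma modulusZ a f t : modulus (a *: f) t = re_part `|a| * modulus f t.
Proof.
by apply: (inc_inj (ler_of_real s)); rewrite of_realM !of_real_norm -normrM.
Qed.

Lemma Lnorm_leP (f : T -> K) (r : R) : 0 <= r ->
  ('N[mu]_+oo [EFin \o modulus f] <= r%:E)%E <->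
  {ae mu, forall t, modulus f t <= r}.
Proof.
move=> r0; rewrite Lnorm.unlock; case: ifPn => [_|].
  have -> : abse \o (EFin \o modulus f) = EFin \o modulus f.
    by apply/funext => t /=; rewrite ger0_norm // modulus_ge0.
  by split=> [/ess_supP|h]; [|apply/ess_supP; move: h]; apply: filterS => t /=;
    rewrite lee_fin.
rewrite -leNgt measure_le0 => /eqP muT0; rewrite lee_fin; split=> // _.
by exists [set: T]; split.
Qed.

Lemma Lnorm_finE (f : T -> K) : finite_norm mu +oo (modulus f) ->
  ('N[mu]_+oo [EFin \o modulus f])%E = (linf f)%:E.
Proof.
by move=> fin; rewrite /linf fineK // ge0_fin_numE // Lnorm_ge0.
Qed.

Lemma linf_ge0 f : 0 <= linf f.
Proof. by rewrite fine_ge0 // Lnorm_ge0. Qed.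

Lemma linf_ae (f : T -> K) : finite_norm mu +oo (modulus f) ->
  {ae mu, forall t, modulus f t <= linf f}.
Proof. by move=> fin; apply/Lnorm_leP; rewrite ?linf_ge0 // Lnorm_finE. Qed.

Lemma ae_linf (f : T -> K) (r : R) : 0 <= r ->
  {ae mu, forall t, modulus f t <= r} ->
  finite_norm mu +oo (modulus f) /\ linf f <= r.
Proof.
move=> r0 /(Lnorm_leP f r0) h.
have fin : finite_norm mu +oo (modulus f) by rewrite /finite_norm (le_lt_trans h) ?ltry.
by split=> //; rewrite -lee_fin -Lnorm_finE.
Qed.

Lemma Linfty_submod : submod_closed Linfty_pred.
Proof.
split.
  rewrite inE; split.
    split; rewrite (_ : (fun _ => _) = cst 0); try exact: measurable_cst;
      by apply/funext => t; rewrite (re_part0, im_part0).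
  apply: (ae_linf (lexx 0) _).1; apply: nearW => t.
  by rewrite /modulus normr0 re_part0.
move=> a f g; rewrite !inE => -[[f1 f2] ff] [[g1 g2] gf]; split; first split.
- rewrite (_ : (fun t => _) = (fun t => re_part a * re_part (f t) -
     im_part a * im_part (f t) + re_part (g t))).
    apply: measurable_funD => //.
    by apply: measurable_funB; apply: measurable_funM => //; exact: measurable_cst.
  by apply/funext => t; rewrite -re_partM -re_partD.
- rewrite (_ : (fun t => _) = (fun t => re_part a * im_part (f t) +
     im_part a * re_part (f t) + im_part (g t))).
    apply: measurable_funD => //.
    by apply: measurable_funD; apply: measurable_funM => //; exact: measurable_cst.
  by apply/funext => t; rewrite -im_partM -im_partD.
have a0 : 0 <= re_part `|a| by exact: (modulus_ge0 (fun=> a) point).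
apply: (@ae_linf _ (re_part `|a| * linf f + linf g) _ _).1.
  by rewrite addr_ge0 ?mulr_ge0 ?linf_ge0.
apply: filterS2 (linf_ae ff) (linf_ae gf) => t ft gt.
by rewrite (le_trans (modulusD _ _ _)) // lerD // modulusZ ler_wpM2l.
Qed.

HB.instance Definition _ :=
  GRing.isSubmodClosed.Build _ _ Linfty_pred Linfty_submod.

Record Linfty_fun := LinftyFun {
  Linfty_val :> T -> K;
  Linfty_valP : Linfty_val \in Linfty_pred }.

HB.instance Definition _ := [isSub for Linfty_val].
HB.instance Definition _ := [Choice of Linfty_fun by <:].
HB.instance Definition _ := [SubChoice_isSubLmodule of Linfty_fun by <:].

Lemma Linfty_fin (f : Linfty_fun) : finite_norm mu +oo (modulus f).
Proof. by have := Linfty_valP f; rewrite inE => -[]. Qed.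

Definition Linfty_null : {pred Linfty_fun} :=
  mem [set f : Linfty_fun | {ae mu, forall t, f t = 0}].

Lemma Linfty_null_submod : submod_closed Linfty_null.
Proof.
split=> [|a f g]; rewrite !inE /=; first exact: nearW.
apply: filterS2 => t ft gt.
by rewrite [LHS](_ : _ = a * f t + g t) // ft gt mulr0 addr0.
Qed.

HB.instance Definition _ :=
  GRing.isSubmodClosed.Build _ _ Linfty_null Linfty_null_submod.

Definition Linfty := Quotient.quot Linfty_null.

HB.instance Definition _ := GRing.Zmodule.on Linfty.
HB.instance Definition _ := EqQuotient.on Linfty.

Local Open Scope quotient_scope.

Lemma Linfty_piP (f g : Linfty_fun) :
  \pi_Linfty f = \pi_Linfty g <-> {ae mu, forall t, f t = g t}.
Proof.
split=> [/eqP|h].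
  rewrite -Quotient.idealrBE inE; apply: filterS => t /eqP.
  by rewrite subr_eq0 => /eqP.
apply/eqP; rewrite -Quotient.idealrBE inE; apply: filterS h => t.
by move=> e; apply/eqP; rewrite subr_eq0; exact/eqP.
Qed.

Lemma Linfty_reprP (f : Linfty_fun) :
  {ae mu, forall t, repr (\pi_Linfty f) t = f t}.
Proof. by apply/Linfty_piP; rewrite reprK. Qed.

Definition Linfty_scale (a : K) (u : Linfty) : Linfty := \pi_Linfty (a *: repr u).

Lemma Linfty_piD (f g : Linfty_fun) :
  \pi_Linfty (f + g) = \pi_Linfty f + \pi_Linfty g.
Proof. exact: Quotient.pi_add. Qed.

Lemma Linfty_pi0 : \pi_Linfty 0 = 0.
Proof. by apply: (@addrI _ (\pi_Linfty 0)); rewrite -Linfty_piD !addr0. Qed.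

Lemma Linfty_piZ a (f : Linfty_fun) :
  \pi_Linfty (a *: f) = Linfty_scale a (\pi_Linfty f).
Proof.
apply/Linfty_piP; apply: filterS (Linfty_reprP f) => t.
by rewrite /= /GRing.scale /= => ->.
Qed.

Lemma Linfty_scaleA a b u :
  Linfty_scale a (Linfty_scale b u) = Linfty_scale (a * b) u.
Proof. by elim/quotW: u => f; rewrite -(Linfty_piZ b) -!Linfty_piZ scalerA. Qed.

Lemma Linfty_scale1 : left_id 1 Linfty_scale.
Proof. by elim/quotW => f; rewrite -Linfty_piZ scale1r. Qed.

Lemma Linfty_scaleDr : right_distributive Linfty_scale +%R.
Proof.
move=> a; elim/quotW => f; elim/quotW => g.
by rewrite -Linfty_piD -!Linfty_piZ scalerDr Linfty_piD.
Qed.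

Lemma Linfty_scaleDl u : {morph Linfty_scale^~ u : a b / a + b}.
Proof. by move=> a b; elim/quotW: u => f; rewrite -!Linfty_piZ scalerDl Linfty_piD. Qed.

HB.instance Definition _ := GRing.Zmodule_isLmodule.Build K Linfty
  Linfty_scaleA Linfty_scale1 Linfty_scaleDr Linfty_scaleDl.

(** ['N[mu]_+oo] is the essential supremum when [mu] is nonzero, and 0 otherwise;
    the choice of the representative is irrelevant by [Linfty_norm_pi]. *)
Definition Linfty_norm (u : Linfty) : K := of_real s (linf (repr u)).

Lemma eq_linf (f g : Linfty_fun) :
  {ae mu, forall t, f t = g t} -> linf f = linf g.
Proof.
move=> h; apply/eqP; rewrite eq_le; apply/andP; split.
  apply: (ae_linf (linf_ge0 g) _).2.
  by apply: filterS2 h (linf_ae (Linfty_fin g)) => t e; rewrite /modulus e.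
apply: (ae_linf (linf_ge0 f) _).2.
by apply: filterS2 h (linf_ae (Linfty_fin f)) => t e; rewrite /modulus e.
Qed.

Lemma Linfty_norm_pi (f : Linfty_fun) :
  Linfty_norm (\pi_Linfty f) = of_real s (linf f).
Proof. by rewrite /Linfty_norm (eq_linf (Linfty_reprP f)). Qed.

Lemma Linfty_normD u v : Linfty_norm (u + v) <= Linfty_norm u + Linfty_norm v.
Proof.
elim/quotW: u => f; elim/quotW: v => g.
rewrite -Linfty_piD !Linfty_norm_pi -of_realD ler_of_real.
apply: (ae_linf _ _).2; first by rewrite addr_ge0 ?linf_ge0.
apply: filterS2 (linf_ae (Linfty_fin f)) (linf_ae (Linfty_fin g)).
by move=> t ft gt; rewrite (le_trans (modulusD _ _ _)) // lerD.
Qed.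

Let linfZ_le a (f : Linfty_fun) : linf (a *: f) <= re_part `|a| * linf f.
Proof.
have a0 : 0 <= re_part `|a| by exact: (modulus_ge0 (fun=> a) point).
apply: (ae_linf _ _).2; first by rewrite mulr_ge0 ?linf_ge0.
apply: filterS (linf_ae (Linfty_fin f)) => t ft.
by rewrite modulusZ ler_wpM2l.
Qed.

Lemma Linfty_normZ a u : Linfty_norm (a *: u) = `|a| * Linfty_norm u.
Proof.
elim/quotW: u => f; rewrite -[_ *: _]Linfty_piZ !Linfty_norm_pi.
rewrite -[`|a|]of_real_norm -of_realM; congr of_real.
apply/eqP; rewrite eq_le linfZ_le /=.
have [->|a0] := eqVneq a 0.
  by rewrite normr0 re_part0 mul0r linf_ge0.
have := linfZ_le a^-1 (a *: f); rewrite scalerA mulVf // scale1r.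
have aa : re_part `|a| * re_part `|a^-1| = 1.
  apply: (inc_inj (ler_of_real s)); rewrite of_realM !of_real_norm -normrM mulfV //.
  by rewrite normr1 of_real1.
have r0 : 0 <= re_part `|a| by exact: (modulus_ge0 (fun=> a) point).
by move=> /(ler_wpM2l r0); rewrite mulrA aa mul1r.
Qed.

Lemma Linfty_norm_eq0 u : Linfty_norm u = 0 -> u = 0.
Proof.
elim/quotW: u => f; rewrite Linfty_norm_pi => h.
have {h} f0 : linf f = 0.
  by rewrite -(re_partK s (linf _)) h re_part0.
rewrite -Linfty_pi0.
apply/Linfty_piP; apply: filterS (linf_ae (Linfty_fin f)) => t.
rewrite f0 => mt; apply/normr0_eq0; rewrite -of_real_norm.
have -> : re_part `|f t| = 0 by apply/eqP; rewrite eq_le mt modulus_ge0.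
exact: of_real0.
Qed.

HB.instance Definition _ := Lmodule_isNormed.Build K Linfty
  Linfty_normD Linfty_normZ Linfty_norm_eq0.

End Linfty.

Section sequence_spaces.
Variables (R : realType) (s : scalar_kind).
Local Notation K := (scalar_field R s).

Definition canonical_vector (n : nat) : nat -> K := fun k => (k == n)%:R.

Definition l1_norm (x : nat -> K) : \bar R :=
  (\sum_(0 <= n <oo) (re_part `|x n|)%:E)%E.

Definition sup_norm (x : nat -> K) : \bar R :=
  ereal_sup [set (re_part `|x n|)%:E | n in [set: nat]].

(** The inclusion of the space into the scalar sequences is the injective linear
    map [bss_seq].  The two inclusions between [l_1], the space and [l_oo] are
    required to be contractive; their norms are then exactly one, because
    [1 = sup_norm e_n <= `|e_n| <= l1_norm e_n = 1]. *)
Record banach_sequence_space := BanachSequenceSpace {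
  bss_carrier :> completeNormedModType K;
  bss_seq : {linear bss_carrier -> (nat -> K)};
  bss_inj : injective bss_seq;
  bss_l1 : forall x : nat -> K, (l1_norm x < +oo)%E ->
    exists2 y : bss_carrier, bss_seq y = x & ((rnorm y)%:E <= l1_norm x)%E;
  bss_loo : forall y : bss_carrier, (sup_norm (bss_seq y) <= (rnorm y)%:E)%E;
  bss_solid : forall (x : nat -> K) (y : bss_carrier),
    (forall n, `|x n| <= `|bss_seq y n|) ->
    exists2 z : bss_carrier, bss_seq z = x & `|z| <= `|y| }.

Variables (X : banach_sequence_space) (N : nat).

(** The span of the first [N] canonical vectors; sequences are indexed from 0. *)
Definition section_pred : {pred X} :=
  mem [set x : X | exists a : 'I_N -> K,
    bss_seq X x = \sum_(i < N) a i *: canonical_vector i].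

Lemma section_submod : submod_closed section_pred.
Proof.
split=> [|c x y]; rewrite !inE /=.
  by exists (fun=> 0); rewrite linear0 big1 // => i _; rewrite scale0r.
move=> [a xa] [b yb]; exists (fun i => c * a i + b i).
rewrite linearP xa yb scaler_sumr -big_split /=; apply: eq_bigr => i _.
by rewrite scalerA scalerDl.
Qed.

HB.instance Definition _ :=
  GRing.isSubmodClosed.Build _ _ section_pred section_submod.

Record bss_section := BssSection {
  section_val :> X;
  section_valP : section_val \in section_pred }.

HB.instance Definition _ := [isSub for section_val].
HB.instance Definition _ := [Choice of bss_section by <:].
HB.instance Definition _ := [SubChoice_isSubLmodule of bss_section by <:].

Definition section_norm (x : bss_section) : K := `|section_val x|.

Lemma section_normD x y : section_norm (x + y) <= section_norm x + section_norm y.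
Proof. exact: ler_normD. Qed.

Lemma section_normZ a x : section_norm (a *: x) = `|a| * section_norm x.
Proof. exact: normrZ. Qed.

Lemma section_norm_eq0 x : section_norm x = 0 -> x = 0.
Proof. by move=> /normr0_eq0 x0; apply: val_inj. Qed.

HB.instance Definition _ := Lmodule_isNormed.Build K bss_section
  section_normD section_normZ section_norm_eq0.

End sequence_spaces.

Section operators.
Variables (R : realType) (s : scalar_kind).
Local Notation K := (scalar_field R s).

Definition opnorm (E F : normedModType K) (f : E -> F) : \bar R :=
  ereal_sup [set (rnorm (f x))%:E | x in [set x | rnorm x <= 1]].

Definition uniformly_complemented_by (C : R) (E : nat -> normedModType K)
    (Z : normedModType K) :=
  forall N, exists (i : {linear E N -> Z}) (q : {linear Z -> E N}),
    [/\ continuous i, continuous q, forall x, q (i x) = x &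
        (opnorm i * opnorm q <= C%:E)%E].

Definition uniformly_complemented (E : nat -> normedModType K)
    (Z : normedModType K) := exists C : R, uniformly_complemented_by C E Z.

(** The distance is infinite when the spaces are not isomorphic. *)
Definition banach_mazur (E F : normedModType K) : \bar R :=
  ereal_inf [set r | exists (u : {linear E -> F}) (v : {linear F -> E}),
    [/\ continuous u, continuous v, cancel u v, cancel v u &
        r = (opnorm u * opnorm v)%E]].

End operators.

(* Main.v *)
From HB Require Import structures.
Require Import Defs.
From mathcomp Require Import all_boot all_order all_algebra.
From mathcomp Require Import all_classical all_reals all_analysis.
From mathcomp Require Import measurable_realfun generic_quotient complex lra ring.
Set Implicit Arguments.
Unset Strict Implicit.
Unset Printing Implicit Defensive.
Import Order.TTheory GRing.Theory Num.Theory.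
Import numFieldNormedType.Exports.
Local Open Scope classical_set_scope.
Local Open Scope ring_scope.

(** The coordinate map [X_N -> l_oo^N] has norm at most one, and by solidity its
    inverse has norm [||e_1 + ... + e_N||].  So everything reduces to bounding
    this one number independently of [N].

    Let [i : X_N -> L_oo] and [q : L_oo -> X_N] with [q o i = id]; after
    rescaling, [||i|| <= 1] and [||q|| <= C] with [C >= 1].  Put [x_j = i e_j].
    The bound rests on a single averaging argument ([rnorm_comb_le]): if
    [sum_j |a_j x_j|^2 <= sigma^2] almost everywhere, separately for the real
    and for the imaginary parts of the [x_j], then
    [||sum_j a_j e_j|| <= 16 C^2 sigma].  For a choice of signs [eps] let [t_eps]
    be the function [sum_j eps_j a_j x_j] truncated at a level [L] of order
    [C sigma].  Truncation moves a sign sum so little that averaging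
    [eps_i t_eps] over all signs still returns [a_i x_i] up to an error of order
    [|a_i| / C] ([clip_sgn_sum_coef]).  Hence the mean of [eps_i (q t_eps)_i] is
    at least [|a_i| / 2] in modulus, for every [i] at once; so
    [sum_j a_j e_j] is dominated coordinatewise by twice the mean of the
    [|q t_eps|], and solidity gives norm at most [2 C sup ||t_eps|| <= 4 C L].

    The argument is used twice.  Since [|x_j| <= 1], it applies to any [a] with
    [sigma] its Euclidean norm, and gives [||sum_j a_j e_j|| <= D ||a||_2] with
    [D = 16 C^2] ([rnorm_comb_le_l2]).  Thus [|sum_j a_j x_j| <= D ||a||_2] almost
    everywhere, simultaneously for a countable set of real [a], and testing on
    rational approximations of [(x_j)_j] itself shows that the square
    functions of [(Re x_j)_j] and [(Im x_j)_j] are bounded ([ae_l2_bound]).  This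
    is the hypothesis of the averaging argument for [a = (1, ..., 1)], whose
    conclusion is the required bound ([rnorm_sum_unit_le]).  The method replaces
    the Grothendieck inequality, which usually carries results of this kind, by
    an orthogonality computation for random signs. *)

(** * Truncation and averages over signs *)

Section truncation.
Variable R : realDomainType.
Implicit Types L u v : R.

Definition clip L u : R := Num.max (- L) (Num.min u L).

Lemma norm_clip L u : 0 <= L -> `|clip L u| <= L.
Proof.
move=> L0; rewrite ler_norml /clip le_max lexx /= ge_max ge_min lexx orbT andbT.
lra.
Qed.

Lemma clip_cases L u : 0 < L ->
  [\/ [/\ `|u| <= L & clip L u = u], L < u /\ clip L u = L
    | u < - L /\ clip L u = - L].
Proof.
move=> L0; rewrite /clip; case: (leP u L) => uL; case: (leP (- L) u) => Lu.
- by apply: Or31; rewrite ler_norml Lu.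
- by apply: Or33.
- by apply: Or32; rewrite max_r //; lra.
- by apply: Or33; lra.
Qed.

Lemma clip_defect_lipschitz L u v : 0 < L ->
  `|(clip L u - u) - (clip L v - v)| <= `|u - v|.
Proof.
move=> L0; rewrite ler_norml.
have [[uL ->]|[uL ->]|[uL ->]] := clip_cases u L0;
have [[vL ->]|[vL ->]|[vL ->]] := clip_cases v L0;
  rewrite ?ler_norml in uL vL; case: (ler0P (u - v)) => uv; lra.
Qed.

(** The defect [clip L u - u] is 1-Lipschitz and vanishes on [[-L, L]]; outside
    that interval [L ^+ 2] is at most [u ^+ 2] or [v ^+ 2].  The factor [`|u - v|]
    is what makes the errors below proportional to a single coefficient. *)
Lemma clip_defect L u v : 0 < L ->
  `|(clip L u - u) - (clip L v - v)| * L ^+ 2 <= `|u - v| * (u ^+ 2 + v ^+ 2).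
Proof.
move=> L0.
have far x y : ~~ (`|x| <= L) -> L ^+ 2 <= x ^+ 2 + y ^+ 2.
  rewrite -ltNge => Lx; apply: ler_wpDr (sqr_ge0 y) _.
  by rewrite -(real_normK (num_real x)) lerXn2r ?nnegrE ?(ltW Lx) ?(ltW L0).
have [uL|/(far _ v) uL] := boolP (`|u| <= L); last first.
  by rewrite ler_pM ?sqr_ge0 ?clip_defect_lipschitz.
have [vL|/(far _ u) vL] := boolP (`|v| <= L); last first.
  by rewrite addrC in vL; rewrite ler_pM ?sqr_ge0 ?clip_defect_lipschitz.
have id x : `|x| <= L -> clip L x = x.
  rewrite ler_norml => xL.
  by have [[_ ->]|[xL' _]|[xL' _]] := clip_cases x L0 => //; lra.
by rewrite !id // !subrr normr0 mul0r mulr_ge0 // addr_ge0 ?sqr_ge0.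
Qed.
End truncation.

Section signs.
Variables (R : realDomainType) (I : finType).
Implicit Types (e : {ffun I -> bool}) (i j : I) (c : I -> R).

Definition sgn e i : R := (-1) ^+ e i.

Definition flip i e : {ffun I -> bool} := [ffun j => e j (+) (j == i)].

Lemma flipK i : involutive (flip i).
Proof. by move=> e; apply/ffunP => j; rewrite !ffunE -addbA addbb addbF. Qed.

Lemma sgn_flip i e j : sgn (flip i e) j = (-1) ^+ (j == i) * sgn e j.
Proof. by rewrite /sgn ffunE signr_addb mulrC. Qed.

Lemma sgn_flip_same i e : sgn (flip i e) i = - sgn e i.
Proof. by rewrite sgn_flip eqxx expr1 mulN1r. Qed.

Lemma norm_sgn e i : `|sgn e i| = 1.
Proof. exact: normr_sign. Qed.

Local Notation nsigns := (#|{ffun I -> bool}|%:R).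

Lemma sum_flip (V : nmodType) i (F : {ffun I -> bool} -> V) :
  \sum_e F (flip i e) = \sum_e F e.
Proof. by rewrite [RHS](reindex_inj (can_inj (flipK i))). Qed.

Definition sgn_sum c e : R := \sum_j sgn e j * c j.

Lemma sgn_sum_flip c i e : sgn_sum c (flip i e) = sgn_sum c e - 2 * (sgn e i * c i).
Proof.
rewrite /sgn_sum (bigD1 i) //= [in RHS](bigD1 i) //= sgn_flip_same.
under eq_bigr => j /negbTE ji do rewrite sgn_flip ji mul1r.
by ring.
Qed.

(** For [i != j] the involution [flip i] changes the sign of every term. *)
Lemma sgn_orthogonal i j :
  \sum_e sgn e i * sgn e j = (i == j)%:R * nsigns.
Proof.
have [->|ij] := eqVneq i j.
  under eq_bigr => e _ do rewrite /sgn -signr_addb addbb.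
  by rewrite sumr_const mul1r.
have : \sum_e sgn e i * sgn e j = - \sum_e sgn e i * sgn e j.
  rewrite -[LHS](sum_flip i) -sumrN; apply: eq_bigr => e _.
  by rewrite sgn_flip_same sgn_flip eq_sym (negbTE ij) mul1r mulNr.
by rewrite mul0r; lra.
Qed.

Lemma sgn_sum_coef c i : \sum_e sgn e i * sgn_sum c e = nsigns * c i.
Proof.
under eq_bigr => e _ do rewrite mulr_sumr.
rewrite exchange_big (bigD1 i) //= [X in _ + X]big1 ?addr0 => [|j ji].
  under eq_bigr => e _ do rewrite mulrA.
  by rewrite -mulr_suml sgn_orthogonal eqxx mul1r.
under eq_bigr => e _ do rewrite mulrA.
by rewrite -mulr_suml sgn_orthogonal eq_sym (negbTE ji) !mul0r.
Qed.

Lemma sgn_sum_sqr c : \sum_e sgn_sum c e ^+ 2 = nsigns * \sum_j c j ^+ 2.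
Proof.
under eq_bigr => e _ do rewrite expr2 {1}/sgn_sum mulr_suml.
rewrite exchange_big mulr_sumr; apply: eq_bigr => j _ /=.
under eq_bigr => e _ do rewrite mulrAC mulrC.
by rewrite -mulr_sumr sgn_sum_coef; ring.
Qed.

(** Truncating a sign sum hardly changes its [i]-th Rademacher coefficient.
    Pairing [eps] with [flip i eps] turns the error into differences of truncation
    defects at two points that are [2 |c_i|] apart, so it is small relative to
    [c_i], and not only relative to the size of the whole sum. *)
Lemma clip_sgn_sum_coef c i L : 0 < L ->
  `|(\sum_e sgn e i * clip L (sgn_sum c e)) - nsigns * c i| * L ^+ 2
    <= nsigns * (2 * `|c i| * \sum_j c j ^+ 2).
Proof.
move=> L0; pose h u := clip L u - u.
rewrite -sgn_sum_coef -sumrB; under eq_bigr => e _ do rewrite -mulrBr.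
have -> : \sum_e sgn e i * (clip L (sgn_sum c e) - sgn_sum c e)
    = \sum_e sgn e i * h (sgn_sum c e) by [].
set D := \sum_e _.
have D2 : 2 * D = \sum_e sgn e i * (h (sgn_sum c e) - h (sgn_sum c (flip i e))).
  rewrite mulr2n mulrDl mul1r {2}/D -(sum_flip i) -big_split.
  by apply: eq_bigr => e _ /=; rewrite sgn_flip_same; ring.
have bound : `|2 * D| * L ^+ 2
    <= \sum_e 2 * `|c i| * (sgn_sum c e ^+ 2 + sgn_sum c (flip i e) ^+ 2).
  rewrite D2 (le_trans (ler_wpM2r (sqr_ge0 L) (ler_norm_sum _ _ _))) //.
  rewrite mulr_suml ler_sum // => e _; rewrite normrM norm_sgn mul1r.
  rewrite (le_trans (clip_defect _ _ L0)) // ler_wpM2r //.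
    by rewrite addr_ge0 ?sqr_ge0.
  rewrite sgn_sum_flip opprB addrC subrK !normrM norm_sgn mul1r.
  by rewrite ger0_norm.
move: bound; rewrite -mulr_sumr big_split /= (sum_flip i (fun e => sgn_sum c e ^+ 2)).
by rewrite sgn_sum_sqr normrM (ger0_norm (ler0n _ 2)); lra.
Qed.
End signs.

(** * Scalars by real and imaginary parts *)

Section scalars.
Variables (R : realType) (s : scalar_kind).
Local Notation K := (scalar_field R s).

(** Over the reals the second component is discarded, in accordance with
    [im_part] being zero there; this lets both scalar fields be treated at once. *)
Definition mk_scalar (u v : R) : K :=
  match s return scalar_field R s with
  | RealScalars => u | ComplexScalars => Complex u v end.

Lemma mk_scalarK (z : K) : mk_scalar (re_part z) (im_part z) = z.
Proof. by rewrite /mk_scalar; case: s z => // -[]. Qed.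

Lemma re_mk_scalar u v : re_part (mk_scalar u v) = u.
Proof. by rewrite /mk_scalar; case: s. Qed.

Lemma measurable_im_mk_scalar d (T : measurableType d) (f g : T -> R) :
  measurable_fun [set: T] g ->
  measurable_fun [set: T] (fun t => im_part (mk_scalar (f t) (g t))).
Proof. by rewrite /mk_scalar; case: s => //= _; exact: measurable_cst. Qed.

Lemma mk_scalarB u v u' v' :
  mk_scalar u v - mk_scalar u' v' = mk_scalar (u - u') (v - v').
Proof. by rewrite /mk_scalar; case: s. Qed.

Lemma mk_scalar_sum (I : finType) (a : I -> R) (u v : I -> R) :
  \sum_i of_real s (a i) * mk_scalar (u i) (v i)
    = mk_scalar (\sum_i a i * u i) (\sum_i a i * v i).
Proof.
rewrite /mk_scalar; case: s => //.
elim/big_rec3: _ => // i x y z _ ->.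
by apply/eqP; rewrite eq_complex /= !mul0r subr0 addr0 !eqxx.
Qed.

Lemma of_real_sum (I : finType) (a : I -> R) :
  \sum_i of_real s (a i) = of_real s (\sum_i a i).
Proof.
by elim/big_rec2: _ => [|i x y _ ->]; rewrite ?of_real0 ?of_realD.
Qed.

Definition absK (z : K) : R := re_part `|z|.

Lemma absKE z : of_real s (absK z) = `|z|.
Proof. exact: of_real_norm. Qed.

Lemma le_absK z w : (absK z <= absK w) = (`|z| <= `|w|).
Proof. by rewrite -(ler_of_real s) !absKE. Qed.

Lemma absK_ge0 z : 0 <= absK z.
Proof. by rewrite -(ler_of_real s) absKE of_real0. Qed.

Lemma absKD z w : absK (z + w) <= absK z + absK w.
Proof. by rewrite -(ler_of_real s) of_realD !absKE ler_normD. Qed.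

Lemma absKM z w : absK (z * w) = absK z * absK w.
Proof. by apply: (inc_inj (ler_of_real s)); rewrite of_realM !absKE normrM. Qed.

Lemma absKN z : absK (- z) = absK z.
Proof. by rewrite /absK normrN. Qed.

Lemma absK_real a : absK (of_real s a) = `|a|.
Proof.
rewrite /absK; case: s => //=.
by rewrite expr0n addr0 sqrtr_sqr.
Qed.

Lemma absK0 : absK 0 = 0.
Proof. by rewrite -(of_real0 _ s) absK_real normr0. Qed.

Lemma absK_sum (I : finType) (F : I -> K) : absK (\sum_i F i) <= \sum_i absK (F i).
Proof.
elim/big_rec2: _ => [|i y z _ h]; first by rewrite absK0.
by rewrite (le_trans (absKD _ _)) // lerD2l.
Qed.

Lemma absK_mk u v : absK (mk_scalar u v) <= `|u| + `|v|.
Proof.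
rewrite /mk_scalar /absK; case: s => /=; first by rewrite lerDl.
rewrite -[leRHS]ger0_norm ?addr_ge0 // -sqrtr_sqr ler_wsqrtr //.
rewrite -(real_normK (num_real u)) -(real_normK (num_real v)).
have := mulr_ge0 (normr_ge0 u) (normr_ge0 v).
by rewrite sqrrD; lra.
Qed.

Lemma norm_re_le (z : K) : `|re_part z| <= absK z.
Proof.
rewrite /absK; case: s z => //= -[a b] /=.
by rewrite -sqrtr_sqr ler_wsqrtr // lerDl sqr_ge0.
Qed.

Lemma norm_im_le (z : K) : `|im_part z| <= absK z.
Proof.
rewrite /absK; case: s z => [z|[a b]] /=; first by rewrite normr0.
by rewrite -sqrtr_sqr ler_wsqrtr // lerDr sqr_ge0.
Qed.

Lemma re_of_realM a (z : K) : re_part (of_real s a * z) = a * re_part z.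
Proof. by case: s z => //= -[x y] /=; rewrite mul0r subr0. Qed.

Lemma im_of_realM a (z : K) : im_part (of_real s a * z) = a * im_part z.
Proof. by case: s z => [|[x y]] /=; rewrite ?mulr0 // mul0r addr0. Qed.

Lemma re_part_sum (I : finType) (F : I -> K) :
  re_part (\sum_i F i) = \sum_i re_part (F i).
Proof. by elim/big_rec2: _ => [|i x y _ <-]; rewrite ?re_part0 ?re_partD. Qed.

Lemma im_part_sum (I : finType) (F : I -> K) :
  im_part (\sum_i F i) = \sum_i im_part (F i).
Proof. by elim/big_rec2: _ => [|i x y _ <-]; rewrite ?im_part0 ?im_partD. Qed.

Lemma rnormE (E : normedModType K) (x : E) : of_real s (rnorm x) = `|x|.
Proof.
by rewrite -[RHS]normr_id -[`|(`|x|)|]absKE /absK normr_id.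
Qed.

Lemma le_rnorm (E F : normedModType K) (x : E) (y : F) :
  (rnorm x <= rnorm y) = (`|x| <= `|y|).
Proof. by rewrite -(ler_of_real s) !rnormE. Qed.

Lemma rnorm_ge0 (E : normedModType K) (x : E) : 0 <= rnorm x.
Proof. by rewrite -(ler_of_real s) rnormE of_real0. Qed.

Lemma rnorm0 (E : normedModType K) : rnorm (0 : E) = 0.
Proof. by rewrite /rnorm normr0 re_part0. Qed.

Lemma rnorm_eq0 (E : normedModType K) (x : E) : rnorm x = 0 -> x = 0.
Proof. by move=> x0; apply: normr0_eq0; rewrite -rnormE x0 of_real0. Qed.

Lemma rnormZ (E : normedModType K) a (x : E) : rnorm (a *: x) = absK a * rnorm x.
Proof.
by apply: (inc_inj (ler_of_real s)); rewrite of_realM absKE !rnormE normrZ.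
Qed.

Lemma rnormZ_real (E : normedModType K) a (x : E) :
  rnorm (of_real s a *: x) = `|a| * rnorm x.
Proof. by rewrite rnormZ absK_real. Qed.

Lemma rnorm_sum (E : normedModType K) (I : finType) (F : I -> E) :
  rnorm (\sum_i F i) <= \sum_i rnorm (F i).
Proof.
rewrite -(ler_of_real s) rnormE -of_real_sum.
rewrite [leRHS](eq_bigr _ (fun i _ => rnormE (F i))).
exact: ler_norm_sum.
Qed.
End scalars.

(** * Classes of essentially bounded functions *)

Section Linfty_elements.
Variables (R : realType) (s : scalar_kind).
Local Notation K := (scalar_field R s).
Variables (d : measure_display) (T : measurableType d).
Variable mu : {measure set T -> \bar R}.
Local Open Scope quotient_scope.

Local Notation class f := (\pi_(Linfty s mu) f).

Lemma Linfty_fun_sumE (I : finType) (c : I -> K) (f : I -> Linfty_fun s mu) t :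
  (\sum_i c i *: f i) t = \sum_i c i * f i t.
Proof. by elim/big_rec2: _ => // i y z _ <-. Qed.

Lemma Linfty_classZ (c : K) (f : Linfty_fun s mu) : class (c *: f) = c *: class f.
Proof. exact: Linfty_piZ. Qed.

Lemma Linfty_class_sum (I : finType) (c : I -> K) (f : I -> Linfty_fun s mu) :
  class (\sum_i c i *: f i) = \sum_i c i *: class (f i).
Proof.
elim/big_rec2: _ => [|i y z _ <-]; first exact: Linfty_pi0.
by rewrite Linfty_piD Linfty_classZ.
Qed.

Lemma rnorm_class (f : Linfty_fun s mu) : rnorm (class f) = linf mu f.
Proof.
by rewrite /rnorm [`|_|]Linfty_norm_pi re_partK.
Qed.

Lemma ae_absK_le_rnorm (f : Linfty_fun s mu) :
  {ae mu, forall t, absK (f t) <= rnorm (class f)}.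
Proof. by rewrite rnorm_class; exact/linf_ae/Linfty_fin. Qed.

Lemma rnorm_le_ae (f : Linfty_fun s mu) (r : R) : 0 <= r ->
  {ae mu, forall t, absK (f t) <= r} -> rnorm (class f) <= r.
Proof. by move=> r0 fr; rewrite rnorm_class; exact: (ae_linf r0 fr).2. Qed.

Lemma measurable_clip L (g : T -> R) : measurable_fun [set: T] g ->
  measurable_fun [set: T] (fun t => clip L (g t)).
Proof.
move=> mg; apply: measurable_maxr; first exact: measurable_cst.
by apply: measurable_minr => //; exact: measurable_cst.
Qed.

(** Real and imaginary parts are truncated separately, so that the estimates for real
    sign sums apply to each of them. *)
Lemma clipped_exists (f : Linfty_fun s mu) (L : R) : 0 <= L ->
  exists g : Linfty_fun s mu, forall t,
    g t = mk_scalar s (clip L (re_part (f t))) (clip L (im_part (f t))).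
Proof.
move=> L0; pose g t := mk_scalar s (clip L (re_part (f t))) (clip L (im_part (f t))).
have /set_mem[[mre mim] _] := Linfty_valP f.
suff gP : g \in Linfty_pred mu by exists (LinftyFun gP).
apply/mem_set; split.
  split; last exact/measurable_im_mk_scalar/measurable_clip.
  by under eq_fun do rewrite re_mk_scalar; exact: measurable_clip.
apply: (@ae_linf _ _ _ _ _ _ (L + L) _ _).1; first by rewrite addr_ge0.
apply: nearW => t; apply: le_trans (absK_mk _ _ _) _.
by rewrite lerD // norm_clip.
Qed.
End Linfty_elements.

(** * Coordinates in a Banach sequence space *)

Section coordinates.
Variables (R : realType) (s : scalar_kind) (X : banach_sequence_space R s).
Local Notation K := (scalar_field R s).

Lemma coordZ (c : K) (z : X) k : bss_seq X (c *: z) k = c * bss_seq X z k.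
Proof. by rewrite linearZ_LR. Qed.

Lemma norm_coord_le (z : X) k : absK (bss_seq X z k) <= rnorm z.
Proof.
by rewrite -lee_fin; apply: le_trans (bss_loo z); apply: ereal_sup_ubound; exists k.
Qed.

Lemma rnorm_solid (y z : X) :
  (forall k, absK (bss_seq X y k) <= absK (bss_seq X z k)) -> rnorm y <= rnorm z.
Proof.
move=> yz; have [k|w wy] := @bss_solid _ _ X (bss_seq X y) z.
  by rewrite -le_absK.
by rewrite le_rnorm -(bss_inj wy).
Qed.

Lemma modulus_exists (z : X) : exists y : X,
  (forall k, bss_seq X y k = of_real s (absK (bss_seq X z k))) /\ rnorm y <= rnorm z.
Proof.
have [k|y yz ny] := @bss_solid _ _ X (fun k => of_real s (absK (bss_seq X z k))) z.
  by rewrite absKE normr_id.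
by exists y; rewrite yz le_rnorm.
Qed.

Lemma l1_norm_canonical n : (l1_norm (canonical_vector R s n : nat -> K) = 1)%E.
Proof.
rewrite /l1_norm (nneseries_split _ n.+1); last first.
  by move=> k _; rewrite lee_fin absK_ge0.
rewrite add0n big_nat_recr //= big_nat big1 => [|k /andP[_ kn]].
  rewrite /canonical_vector eqxx normr1 eseries0 ?adde0 ?add0e.
    by rewrite -(of_real1 _ s) re_partK.
  move=> k nk _; rewrite gtn_eqF // normr0 re_part0 //.
by rewrite /canonical_vector ltn_eqF // normr0 re_part0.
Qed.

Lemma canonical_vector_lift n : exists y : X, bss_seq X y = canonical_vector R s n.
Proof.
have [|y yn _] := @bss_l1 _ _ X (canonical_vector R s n).
  by rewrite l1_norm_canonical ltry.
by exists y.
Qed.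

Lemma coord_sum N (e : 'I_N -> X) (c : 'I_N -> K) k :
  (forall j, bss_seq X (e j) = canonical_vector R s j) ->
  bss_seq X (\sum_j c j *: e j) k = if insub k is Some j then c j else 0.
Proof.
move=> he; have term j : bss_seq X (c j *: e j) k = c j * (k == j)%:R.
  by rewrite coordZ he.
rewrite linear_sum fct_sumE (eq_bigr _ (fun j _ => term j)).
case: insubP => [j _ <-|kN].
  rewrite (bigD1 j) //= eqxx mulr1 big1 ?addr0 // => i ij.
  by rewrite eq_sym (inj_eq val_inj) (negbTE ij) mulr0.
rewrite big1 // => j _; case: eqP => [kj|]; last by rewrite mulr0.
by rewrite kj ltn_ord in kN.
Qed.
End coordinates.

(** * Rational tests for square sums *)

Section rounding.
Variable R : realType.

Lemma rational_rounding (n : nat) (r : R) : (0 < n)%N -> exists z : int,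
  (z%:~R / n%:R) ^+ 2 <= z%:~R / n%:R * r /\
  r ^+ 2 <= 2 * (z%:~R / n%:R) ^+ 2 + 2 / n%:R ^+ 2.
Proof.
move=> n0; wlog r0 : r / 0 <= r => [nonneg|].
  have [/nonneg//|/ltW r0] := leP 0 r.
  have [|z [zr rz]] := nonneg (- r); first by rewrite oppr_ge0.
  by exists (- z); rewrite rmorphN mulNr !sqrrN in zr rz *; rewrite mulNr -mulrN.
have n0' : 0 < n%:R :> R by rewrite ltr0n.
pose z := Num.floor (n%:R * r); exists z.
have z0 : 0 <= z%:~R :> R.
  by rewrite ler0z floor_ge0 mulr_ge0 // ltW.
have zr : z%:~R / n%:R <= r by rewrite ler_pdivrMr // mulrC ge_floor.
have rz : r <= z%:~R / n%:R + n%:R^-1.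
  have -> : z%:~R / n%:R + n%:R^-1 = (z%:~R + 1) / n%:R :> R by rewrite mulrDl mul1r.
  rewrite ler_pdivlMr // mulrC.
  by have := ltW (floorD1_gt (n%:R * r)); rewrite intrD.
have a0 : 0 <= z%:~R / n%:R :> R by rewrite divr_ge0 // ltW.
have i0 : 0 <= n%:R^-1 :> R by rewrite invr_ge0 ltW.
split; first by rewrite expr2 ler_wpM2l.
rewrite -exprVn; set b := n%:R^-1 in rz i0 *; set a := z%:~R / _ in zr rz a0 *.
apply: (@le_trans _ _ ((a + b) ^+ 2)); first by rewrite lerXn2r ?nnegrE ?addr_ge0.
by have := sqr_ge0 (a - b); nra.
Qed.

(** If [p] acts on Euclidean space with norm [D], testing it on [p] itself bounds
    its length.  Testing on an approximation [a] of [p] with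
    [a_j ^+ 2 <= a_j * p_j] works as well and needs only countably many tests,
    hence survives the passage to almost every point.  With
    multiples of [N.+1^-1] the rounding adds at most [2 N / (N + 1)^2 <= 2] to the
    sum of squares. *)
Lemma l2_bound_of_rational_tests (N : nat) (p : 'I_N -> R) (D : R) :
  (forall (z : {ffun 'I_N -> int}) (sigma : R), 0 < sigma ->
     \sum_j ((z j)%:~R / N.+1%:R) ^+ 2 <= sigma ^+ 2 ->
     \sum_j (z j)%:~R / N.+1%:R * p j <= D * sigma) ->
  \sum_j p j ^+ 2 <= 2 * D ^+ 2 + 2.
Proof.
move=> test.
have /choice[z zP] := fun j => rational_rounding (p j) (ltn0Sn N).
pose a j : R := (z j)%:~R / N.+1%:R.
pose Q := \sum_j a j ^+ 2.
have Q_le : Q <= D ^+ 2.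
  have [Q0|Q0] := leP Q 0; first by rewrite (le_trans Q0) ?sqr_ge0.
  have sQ : 0 < Num.sqrt Q by rewrite sqrtr_gt0.
  have sQ2 : Num.sqrt Q ^+ 2 = Q by rewrite sqr_sqrtr // ltW.
  have : Q <= D * Num.sqrt Q.
    have := test [ffun j => z j] _ sQ; rewrite sQ2.
    under eq_bigr => j _ do rewrite ffunE.
    move=> /(_ (lexx _)); under eq_bigr => j _ do rewrite ffunE.
    by apply: le_trans; apply: ler_sum => j _; have [] := zP j.
  rewrite -[in leLHS]sQ2 expr2 ler_pM2r // => sQD.
  by rewrite -sQ2 lerXn2r ?nnegrE ?(ltW sQ) // (le_trans (ltW sQ)).
have N1 : (N%:R / N.+1%:R ^+ 2 <= 1 :> R).
  rewrite ler_pdivrMr ?exprn_gt0 ?ltr0n // mul1r -natrX ler_nat.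
  by rewrite (leq_trans (leqnSn N)) // -{1}(expn1 N.+1) leq_pexp2l.
have : \sum_j p j ^+ 2 <= \sum_(j < N) (2 * a j ^+ 2 + 2 / N.+1%:R ^+ 2).
  by apply: ler_sum => j _; have [] := zP j.
rewrite big_split /= -mulr_sumr sumr_const card_ord -[_ *+ N]mulr_natr -/Q.
have -> : 2 / N.+1%:R ^+ 2 * N%:R = 2 * (N%:R / N.+1%:R ^+ 2) :> R.
  by rewrite mulrAC mulrA.
by move: N1 Q_le; set r := (_ / _); lra.
Qed.
End rounding.

(** * The averaging argument *)

Section factorization.
Variables (R : realType) (s : scalar_kind) (X : banach_sequence_space R s).
Local Notation K := (scalar_field R s).
Variables (d : measure_display) (T : measurableType d).
Variable mu : {measure set T -> \bar R}.
Local Notation Z := (Linfty s mu).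
Local Open Scope quotient_scope.
Variables (N : nat) (e : 'I_N -> X) (x : 'I_N -> Z) (q : {linear Z -> X}) (C : R).
Hypothesis coord_e : forall j, bss_seq X (e j) = canonical_vector R s j.
Hypothesis C1 : 1 <= C.
Hypothesis x_le : forall a : 'I_N -> R,
  rnorm (\sum_j of_real s (a j) *: x j) <= rnorm (\sum_j of_real s (a j) *: e j).
Hypothesis q_le : forall z, rnorm (q z) <= C * rnorm z.
Hypothesis q_x : forall j, q (x j) = e j.

Local Notation xf j := (repr (x j)).
Local Notation nsigns := (#|{ffun 'I_N -> bool}|%:R : R).
Local Notation comb a := (\sum_j of_real s (a j) *: e j).

Let C0 : 0 < C. Proof. by move: C1; lra. Qed.

Lemma rnorm_unit_le1 j : rnorm (e j) <= 1.
Proof.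
have [|y yj] := @bss_l1 _ _ X (canonical_vector R s j).
  by rewrite l1_norm_canonical ltry.
rewrite l1_norm_canonical lee_fin.
by rewrite -(coord_e j) in yj; rewrite (bss_inj yj).
Qed.

Lemma ae_comb_le (a : 'I_N -> R) :
  {ae mu, forall t, absK (\sum_j of_real s (a j) * xf j t) <= rnorm (comb a)}.
Proof.
have := ae_absK_le_rnorm (\sum_j of_real s (a j) *: xf j).
apply: filterS => t; rewrite Linfty_fun_sumE => /le_trans; apply.
rewrite Linfty_class_sum (le_trans _ (x_le a)) //.
by under eq_bigr => j _ do rewrite reprK.
Qed.

Lemma ae_x_le1 : {ae mu, forall t, forall j, absK (xf j t) <= 1}.
Proof.
apply: filter_forall => j.
have := ae_comb_le (fun i => (i == j)%:R); apply: filterS => t.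
have del (V : lmodType K) (F : 'I_N -> V) :
    \sum_i of_real s (i == j)%:R *: F i = F j.
  rewrite (bigD1 j) //= eqxx of_real1 scale1r big1 ?addr0 // => i /negbTE ->.
  by rewrite of_real0 scale0r.
by rewrite (del K^o) del => /le_trans; apply; exact: rnorm_unit_le1.
Qed.

Section clipping.
Variables (a : 'I_N -> R) (sigma : R).
Hypothesis sigma_gt0 : 0 < sigma.
Hypothesis ae_sqr : {ae mu, forall t,
  \sum_j (a j * re_part (xf j t)) ^+ 2 <= sigma ^+ 2 /\
  \sum_j (a j * im_part (xf j t)) ^+ 2 <= sigma ^+ 2}.

(** At this level truncation changes the [i]-th coefficient by at most
    [|a_i| / (4 C)] in the real and in the imaginary part, so that after applying
    [q] half of [a_i] is left. *)
Let L : R := 4 * C * sigma.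
Let L_gt0 : 0 < L. Proof. by rewrite /L !mulr_gt0. Qed.

Let S (eps : {ffun 'I_N -> bool}) : Linfty_fun s mu :=
  \sum_j of_real s (sgn R eps j * a j) *: xf j.

Let re_S eps t : re_part (S eps t) = sgn_sum (fun j => a j * re_part (xf j t)) eps.
Proof.
rewrite Linfty_fun_sumE re_part_sum; apply: eq_bigr => j _.
by rewrite re_of_realM mulrA.
Qed.

Let im_S eps t : im_part (S eps t) = sgn_sum (fun j => a j * im_part (xf j t)) eps.
Proof.
rewrite Linfty_fun_sumE im_part_sum; apply: eq_bigr => j _.
by rewrite im_of_realM mulrA.
Qed.

Let clip_sum_error (c : 'I_N -> R) i :
  `|c i| <= `|a i| -> \sum_j c j ^+ 2 <= sigma ^+ 2 ->
  `|(\sum_eps sgn R eps i * clip L (sgn_sum c eps)) - nsigns * c i|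
    <= nsigns * `|a i| / (4 * C).
Proof.
move=> ca c2; have := clip_sgn_sum_coef c i L_gt0.
set D := `|_ - _| => h.
have n0 : 0 <= nsigns by rewrite ler0n.
have D0 : 0 <= D by exact: normr_ge0.
have s2 : 0 < sigma ^+ 2 by rewrite exprn_gt0.
have {}h : D * L ^+ 2 <= nsigns * (2 * `|a i| * sigma ^+ 2).
  apply: (le_trans h); rewrite ler_wpM2l // ler_pM ?mulr_ge0 ?sumr_ge0 //.
    by move=> j _; exact: sqr_ge0.
  by rewrite ler_wpM2l.
rewrite ler_pdivlMr ?mulr_gt0 // -(ler_pM2r (mulr_gt0 s2 C0)).
have DCs : 0 <= D * C * sigma ^+ 2 by rewrite !mulr_ge0 // ltW.
have := mulr_ge0 DCs (_ : 0 <= C - 1); rewrite subr_ge0 => /(_ C1).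
have na : 0 <= nsigns * `|a i| * sigma ^+ 2 by rewrite !mulr_ge0 // ltW.
have := mulr_ge0 na (_ : 0 <= C - 1); rewrite subr_ge0 => /(_ C1).
by move: h; rewrite /L; nra.
Qed.

(** The mean over all signs of the moduli of the [q t_eps] dominates half of
    [sum_j a_j e_j] coordinatewise, while each truncated sum has norm at most
    [2 L] whatever the norm of the original one. *)
Lemma rnorm_comb_le : rnorm (comb a) <= 16 * C ^+ 2 * sigma.
Proof.
have n0 : 0 < nsigns.
  by rewrite ltr0n; apply/card_gt0P; exists [ffun=> false].
have /choice[t tP] : forall eps, exists g : Linfty_fun s mu, forall w, g w =
    mk_scalar s (clip L (re_part (S eps w))) (clip L (im_part (S eps w))).
  by move=> eps; exact/clipped_exists/ltW.
have t_le eps : rnorm (\pi_Z (t eps)) <= 2 * L.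
  apply: rnorm_le_ae; first by rewrite mulr_ge0 // ltW.
  apply: nearW => w; rewrite tP (le_trans (absK_mk _ _ _)) //.
  by rewrite mulr2n mulrDl mul1r lerD ?norm_clip // ltW.
(* [G i] is the error, in [L_oo], of recovering [a_i x_i] from the [t eps]. *)
pose G i : Linfty_fun s mu :=
  (\sum_eps of_real s (sgn R eps i) *: t eps) - of_real s (nsigns * a i) *: xf i.
have G_le i : rnorm (\pi_Z (G i)) <= nsigns * `|a i| / (2 * C).
  apply: rnorm_le_ae; first by rewrite divr_ge0 ?mulr_ge0 // ltW.
  apply: filterS2 ae_sqr ae_x_le1 => w [re2 im2] /(_ i) xi1.
  have -> : G i w = mk_scalar s
     ((\sum_eps sgn R eps i * clip L (sgn_sum (fun j => a j * re_part (xf j w)) eps))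
        - nsigns * (a i * re_part (xf i w)))
     ((\sum_eps sgn R eps i * clip L (sgn_sum (fun j => a j * im_part (xf j w)) eps))
        - nsigns * (a i * im_part (xf i w))).
    rewrite -mk_scalarB !mulrA -[in RHS]re_of_realM -[in RHS]im_of_realM mk_scalarK.
    rewrite -mk_scalar_sum.
    have -> : G i w = (\sum_eps of_real s (sgn R eps i) *: t eps) w
        - of_real s (nsigns * a i) * xf i w by [].
    rewrite Linfty_fun_sumE; congr (_ - _).
    by apply: eq_bigr => eps _; rewrite tP re_S im_S.
  rewrite (le_trans (absK_mk _ _ _)) //.
  have -> : nsigns * `|a i| / (2 * C) =
      nsigns * `|a i| / (4 * C) + nsigns * `|a i| / (4 * C).
    by field; rewrite gt_eqF.
  rewrite lerD // clip_sum_error // normrM ler_piMr //.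
    by rewrite (le_trans (norm_re_le _)).
  by rewrite (le_trans (norm_im_le _)).
have qG i : q (\pi_Z (G i)) =
    (\sum_eps of_real s (sgn R eps i) *: q (\pi_Z (t eps))) - of_real s (nsigns * a i) *: e i.
  rewrite Linfty_piD -scaleNr Linfty_classZ Linfty_class_sum linearD linear_sum reprK.
  rewrite linearZ_LR q_x scaleNr; congr (_ - _).
  by apply: eq_bigr => eps _; rewrite linearZ_LR.
have /choice[m /all_and2[mE m_le]] := fun eps => modulus_exists (q (\pi_Z (t eps))).
(* [w] is twice the mean of the moduli of the [q (t eps)]. *)
pose w : X := of_real s (2 / nsigns) *: \sum_eps m eps.
have wE k : absK (bss_seq X w k) =
    2 / nsigns * \sum_eps absK (bss_seq X (q (\pi_Z (t eps))) k).
  rewrite coordZ absKM absK_real ger0_norm ?divr_ge0 //; congr (_ * _).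
  rewrite linear_sum fct_sumE (eq_bigr _ (fun eps _ => mE eps k)) of_real_sum absK_real.
  by rewrite ger0_norm // sumr_ge0 // => eps _; exact: absK_ge0.
have w_le : rnorm w <= 4 * C * L.
  rewrite rnormZ_real ger0_norm ?divr_ge0 // mulrAC ler_pdivrMr //.
  have -> : 4 * C * L * nsigns = 2 * \sum_(eps : {ffun 'I_N -> bool}) C * (2 * L).
    by rewrite sumr_const -mulr_natr; ring.
  rewrite ler_wpM2l // (le_trans (rnorm_sum _)) // ler_sum // => eps _.
  by rewrite (le_trans (m_le eps)) // (le_trans (q_le _)) // ler_wpM2l // ltW.
have -> : 16 * C ^+ 2 * sigma = 4 * C * L by rewrite /L; ring.
apply: le_trans w_le; apply: rnorm_solid => k.
rewrite wE coord_sum //; case: insubP => [i _ ik|_]; last first.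
  by rewrite absK0 mulr_ge0 ?divr_ge0 // sumr_ge0 // => eps _; exact: absK_ge0.
have := le_trans (norm_coord_le (q (\pi_Z (G i))) k) (q_le _).
move=> /le_trans/(_ (ler_wpM2l (ltW C0) (G_le i))).
set Q := bss_seq X (q (\pi_Z (G i))) k => Q_le.
have QE : of_real s (nsigns * a i) =
    \sum_eps of_real s (sgn R eps i) * bss_seq X (q (\pi_Z (t eps))) k - Q.
  have ei : bss_seq X (e i) k = 1 by rewrite coord_e -ik /canonical_vector eqxx.
  rewrite /Q qG linearB [X in _ - X]/(bss_seq X _ k - bss_seq X _ k).
  rewrite coordZ ei mulr1 linear_sum fct_sumE (eq_bigr _ (fun eps _ => coordZ _ _ _)).
  by rewrite opprB addrCA subrr addr0.
have : nsigns * `|a i| <=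
    \sum_eps absK (bss_seq X (q (\pi_Z (t eps))) k) + nsigns * `|a i| / 2.
  have nE : nsigns * `|a i| = absK (of_real s (nsigns * a i)).
    by rewrite absK_real normrM (ger0_norm (ltW n0)).
  rewrite [leLHS]nE QE.
  rewrite (le_trans (absKD _ _)) // absKN lerD //.
    rewrite (le_trans (absK_sum _)) // ler_sum // => eps _.
    by rewrite absKM absK_real norm_sgn mul1r.
  apply: le_trans Q_le _; rewrite le_eqVlt; apply/orP; left; apply/eqP.
  by field; rewrite gt_eqF.
rewrite absK_real; set A := \sum_eps _ => nA.
by rewrite mulrAC ler_pdivlMr //; lra.
Qed.

End clipping.

(** Here the pointwise hypothesis of the averaging argument is free, because
    [|x_j| <= 1]. *)
Lemma rnorm_comb_le_l2 (a : 'I_N -> R) (sigma : R) : 0 < sigma ->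
  \sum_j a j ^+ 2 <= sigma ^+ 2 -> rnorm (comb a) <= 16 * C ^+ 2 * sigma.
Proof.
move=> s0 as2; apply: rnorm_comb_le => //; apply: filterS ae_x_le1 => t x1.
have le1 (c : 'I_N -> R) : (forall j, `|c j| <= 1) ->
    \sum_j (a j * c j) ^+ 2 <= sigma ^+ 2.
  move=> c1; apply: le_trans as2; apply: ler_sum => j _.
  rewrite exprMn ler_piMr ?sqr_ge0 // -(real_normK (num_real (c j))).
  by rewrite exprn_ile1.
by split; apply: le1 => j; apply: le_trans (x1 j); [exact: norm_re_le|exact: norm_im_le].
Qed.

Let D : R := 16 * C ^+ 2.

(** The preceding bound transfers through [x_le] to the values of the [x_j], and
    says that they act on Euclidean space with norm [D] at almost every point. *)
Lemma ae_l2_bound : {ae mu, forall t,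
  \sum_j re_part (xf j t) ^+ 2 <= 2 * D ^+ 2 + 2 /\
  \sum_j im_part (xf j t) ^+ 2 <= 2 * D ^+ 2 + 2}.
Proof.
pose a (z : {ffun 'I_N -> int}) j : R := (z j)%:~R / N.+1%:R.
have : {ae mu, forall t, forall n, forall z : {ffun 'I_N -> int},
    unpickle n = Some z ->
    absK (\sum_j of_real s (a z j) * xf j t) <= rnorm (comb (a z))}.
  apply/ae_foralln => n; case: (unpickle n) => [z|]; last exact: nearW.
  by apply: filterS (ae_comb_le (a z)) => t h _ [<-].
apply: filterS => t h.
have test z sigma : 0 < sigma -> \sum_j a z j ^+ 2 <= sigma ^+ 2 ->
    absK (\sum_j of_real s (a z j) * xf j t) <= D * sigma.
  by move=> s0 zs; apply: le_trans (h _ _ (pickleK z)) _; exact: rnorm_comb_le_l2.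
split; apply: l2_bound_of_rational_tests => z sigma s0 zs;
  apply: le_trans (le_trans (ler_norm _) _) (test z sigma s0 zs).
  apply: le_trans (norm_re_le _); rewrite re_part_sum.
  by under [in leRHS]eq_bigr => j _ do rewrite re_of_realM.
apply: le_trans (norm_im_le _); rewrite im_part_sum.
by under [in leRHS]eq_bigr => j _ do rewrite im_of_realM.
Qed.

Lemma rnorm_sum_unit_le : rnorm (\sum_j e j) <= D * (2 * D + 2).
Proof.
have D0 : 0 < D by rewrite mulr_gt0 // exprn_gt0.
have -> : \sum_j e j = comb (fun=> 1).
  by apply: eq_bigr => j _; rewrite of_real1 scale1r.
apply: rnorm_comb_le; first by rewrite addr_gt0 // mulr_gt0.
apply: filterS ae_l2_bound => t [re2 im2].
have sq : 2 * D ^+ 2 + 2 <= (2 * D + 2) ^+ 2 by have := sqr_ge0 D; nra.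
split; apply: le_trans sq.
  by under eq_bigr => j _ do rewrite mul1r.
by under eq_bigr => j _ do rewrite mul1r.
Qed.

End factorization.

(** * Operator norms *)

Section operators.
Variables (R : realType) (s : scalar_kind).
Local Notation K := (scalar_field R s).

Lemma bounded_linear_continuous_rnorm (E F : normedModType K) (f : {linear E -> F})
    (M : R) : 0 <= M -> (forall x, rnorm (f x) <= M * rnorm x) -> continuous f.
Proof.
move=> M0 fM; apply: bounded_linear_continuous; apply/bounded_funP => r.
exists (of_real s M * r) => x xr; rewrite -rnormE.
apply: le_trans (_ : _ <= of_real s M * `|x|) _.
  by rewrite -rnormE -of_realM ler_of_real.
by rewrite ler_wpM2l // -(of_real0 _ s) ler_of_real.
Qed.

Lemma opnorm_ge0 (E F : normedModType K) (f : {linear E -> F}) : (0 <= opnorm f)%E.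
Proof.
apply: ereal_sup_ubound; exists 0; rewrite /= ?linear0 ?rnorm0 //.
Qed.

Lemma opnorm_le (E F : normedModType K) (f : E -> F) (M : R) : 0 <= M ->
  (forall x, rnorm (f x) <= M * rnorm x) -> (opnorm f <= M%:E)%E.
Proof.
move=> M0 fM; apply: ge_ereal_sup => _ [x /= x1 <-].
by rewrite lee_fin (le_trans (fM x)) // ler_piMr.
Qed.

Lemma rnorm_le_opnorm (E F : normedModType K) (f : {linear E -> F}) (M : R) x :
  (opnorm f <= M%:E)%E -> rnorm (f x) <= M * rnorm x.
Proof.
move=> fM; have [x0|x0] := eqVneq (rnorm x) 0.
  by rewrite (rnorm_eq0 x0) linear0 !rnorm0 mulr0.
have xgt0 : 0 < rnorm x by rewrite lt0r x0 rnorm_ge0.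
pose y : E := of_real s (rnorm x)^-1 *: x.
have : ((rnorm (f y))%:E <= M%:E)%E.
  apply: le_trans fM; apply: ereal_sup_ubound; exists y => //=.
  by rewrite rnormZ_real ger0_norm ?invr_ge0 ?(ltW xgt0) // mulVf.
rewrite lee_fin linearZ_LR rnormZ_real ger0_norm ?invr_ge0 ?(ltW xgt0) //.
by rewrite ler_pdivrMl // mulrC.
Qed.

Lemma opnorm_gt0 (E F : normedModType K) (f : {linear E -> F}) x :
  f x != 0 -> (0 < opnorm f)%E.
Proof.
move=> fx; rewrite lt_def opnorm_ge0 andbT; apply: contraNneq fx => f0.
have := @rnorm_le_opnorm _ _ f 0 x; rewrite f0 lexx mul0r => /(_ isT) h.
by apply/eqP/rnorm_eq0/le_anti; rewrite h rnorm_ge0.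
Qed.

(** A bound on the product of the two norms alone allows one of them to be
    infinite and the other zero; the identity [g (f x) = x] at a nonzero [x]
    excludes this. *)
Lemma opnorm_factors (E F : normedModType K) (f : {linear E -> F}) (g : {linear F -> E})
    (C : R) (x : E) : x != 0 -> g (f x) = x -> (opnorm f * opnorm g <= C%:E)%E ->
  exists A B : R, [/\ 0 < A, A * B <= C, forall y, rnorm (f y) <= A * rnorm y &
    forall z, rnorm (g z) <= B * rnorm z].
Proof.
move=> x0 gfx fgC.
have f0 : (0 < opnorm f)%E.
  by apply: (@opnorm_gt0 _ _ f x); apply: contraNneq x0 => fx; rewrite -gfx fx linear0.
have g0 : (0 < opnorm g)%E by apply: (@opnorm_gt0 _ _ g (f x)); rewrite gfx.
have ff : opnorm f \is a fin_num.
  rewrite ge0_fin_numE ?(ltW f0) // ltey; apply: contraTneq fgC => ->.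
  by rewrite gt0_mulye // leye_eq.
have fg : opnorm g \is a fin_num.
  rewrite ge0_fin_numE ?(ltW g0) // ltey; apply: contraTneq fgC => ->.
  by rewrite gt0_muley // leye_eq.
exists (fine (opnorm f)), (fine (opnorm g)); split.
- by rewrite fine_gt0 // f0 -ge0_fin_numE // ltW.
- by rewrite -lee_fin EFinM !fineK.
- by move=> y; apply: rnorm_le_opnorm; rewrite fineK.
- by move=> y; apply: rnorm_le_opnorm; rewrite fineK.
Qed.

Lemma linear_bundle (E F : lmodType K) (f : E -> F) : linear f ->
  exists g : {linear E -> F}, forall x, g x = f x.
Proof.
move=> fP.
pose fL := GRing.isLinear.Build K E F *:%R f fP.
by exists (HB.pack f fL : {linear E -> F}).
Qed.

Lemma rnorm_row_le N (r : 'rV[K]_N) (M : R) : 0 <= M ->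
  (forall j, absK (r 0 j) <= M) -> rnorm r <= M.
Proof.
move=> M0 rM; rewrite -(ler_of_real s) rnormE; change (mx_norm r <= of_real s M).
have [->|/mx_norm_neq0[[i j] ->]] := eqVneq (mx_norm r) 0.
  by rewrite -(of_real0 _ s) ler_of_real.
by rewrite /= -absKE ler_of_real ord1.
Qed.

Lemma absK_row_le N (r : 'rV[K]_N) j : absK (r 0 j) <= rnorm r.
Proof.
rewrite -(ler_of_real s) rnormE absKE [leRHS]mx_normE -[leLHS]nngE num_le.
exact: (le_bigmax _ (fun i => `|r i.1 i.2|%:nng) (0, j)).
Qed.
End operators.

(** * Distance from the sections to finite-dimensional l_oo *)

Section sections_iso.
Variables (R : realType) (s : scalar_kind) (X : banach_sequence_space R s) (N : nat).
Local Notation K := (scalar_field R s).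
Local Notation XN := (bss_section X N : normedModType K).
Variable e : nat -> X.
Hypothesis coord_e : forall j, bss_seq X (e j) = canonical_vector R s j.

Lemma section_val_linear (c : K) (y z : XN) :
  section_val (c *: y + z) = c *: section_val y + section_val z.
Proof. by []. Qed.

Lemma section_comb (c : 'I_N -> K) : exists y : XN, section_val y = \sum_j c j *: e j.
Proof.
suff yP : \sum_j c j *: e j \in @section_pred R s X N by exists (BssSection yP).
apply/mem_set; exists c; rewrite linear_sum; apply: eq_bigr => j _.
by rewrite linearZ_LR coord_e.
Qed.

Lemma section_decomp (y : XN) :
  section_val y = \sum_(j < N) bss_seq X (section_val y) j *: e j.
Proof.
have /set_mem[c yc] := section_valP y.
have {}yc : section_val y = \sum_(j < N) c j *: e j.
  apply: bss_inj; rewrite yc linear_sum; apply: eq_bigr => j _.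
  by rewrite linearZ_LR coord_e.
rewrite {1}yc; apply: eq_bigr => j _; rewrite yc coord_sum // insubT //= => jN.
by congr (c _ *: _); apply: val_inj.
Qed.

(** By solidity the inverse of the coordinate map attains its norm at
    [(1, ..., 1)]. *)
Lemma banach_mazur_section_le (M : R) : rnorm (\sum_(j < N) e j) <= M ->
  (banach_mazur XN ('rV[K]_N : normedModType K) <= M%:E)%E.
Proof.
move=> eM; have M0 : 0 <= M := le_trans (rnorm_ge0 _) eM.
have [u uE] : exists u : {linear XN -> 'rV[K]_N},
    forall y, u y = \row_j bss_seq X (section_val y) j.
  apply: linear_bundle => c y z; apply/rowP => j; rewrite !mxE.
  by rewrite section_val_linear linearP.
have /choice[v0 v0E] := fun r : 'rV[K]_N => section_comb (r 0).
have [v vE] : exists v : {linear 'rV[K]_N -> XN}, forall r, v r = v0 r.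
  apply: linear_bundle => c y z; apply: val_inj.
  change (section_val (v0 (c *: y + z)) = section_val (c *: v0 y + v0 z)).
  rewrite section_val_linear !v0E scaler_sumr -big_split; apply: eq_bigr => j _ /=.
  by rewrite !mxE scalerA scalerDl.
have sum_v r : section_val (v r) = \sum_j r 0 j *: e j by rewrite vE v0E.
have u_le y : rnorm (u y) <= 1 * rnorm y.
  rewrite mul1r uE rnorm_row_le ?rnorm_ge0 // => j.
  by rewrite mxE; exact: norm_coord_le.
have v_le r : rnorm (v r) <= M * rnorm r.
  change (rnorm (section_val (v r)) <= M * rnorm r); rewrite sum_v.
  apply: le_trans (_ : rnorm (of_real s (rnorm r) *: \sum_(j < N) e j) <= _); last first.
    by rewrite rnormZ_real ger0_norm ?rnorm_ge0 // mulrC ler_wpM2r ?rnorm_ge0.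
  rewrite scaler_sumr; apply: rnorm_solid => k; rewrite !coord_sum //.
  case: insubP => // j _ _.
  by rewrite absK_real ger0_norm ?rnorm_ge0 ?absK_row_le.
have uv : cancel u v.
  move=> y; apply: val_inj; change (section_val (v (u y)) = section_val y); rewrite sum_v.
  rewrite [RHS]section_decomp; apply: eq_bigr => j _.
  by rewrite uE mxE.
have vu : cancel v u.
  move=> r; apply/rowP => j; rewrite uE mxE sum_v coord_sum // valK //.
apply: le_trans (_ : (opnorm u * opnorm v <= _)%E).
  apply: ereal_inf_lbound; exists u, v; split=> //.
    exact: bounded_linear_continuous_rnorm u_le.
  exact: bounded_linear_continuous_rnorm v_le.
rewrite -[leRHS]mul1e lee_pmul ?opnorm_ge0 //; first exact: opnorm_le u_le.
exact: opnorm_le v_le.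
Qed.

Variables (d : measure_display) (T : measurableType d).
Variable mu : {measure set T -> \bar R}.
Local Notation Z := (Linfty s mu : normedModType K).

(** The embedding is divided by its norm bound [A] and the projection multiplied by
    it, which leaves the composition unchanged and makes the embedding
    contractive. *)
Lemma rnorm_sum_le_of_complemented (C : R) (i : {linear XN -> Z}) (q : {linear Z -> XN}) :
  1 <= C -> (forall x, q (i x) = x) -> (opnorm i * opnorm q <= C%:E)%E ->
  rnorm (\sum_(j < N) e j) <= 16 * C ^+ 2 * (2 * (16 * C ^+ 2) + 2).
Proof.
move=> C1 qi iqC.
have bound0 : 0 <= 16 * C ^+ 2 * (2 * (16 * C ^+ 2) + 2).
  by rewrite mulr_ge0 ?addr_ge0 ?mulr_ge0 ?exprn_ge0 // (le_trans ler01).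
have [N0|N0] := posnP N.
  rewrite big1 ?rnorm0 // => j _; have := ltn_ord j; by rewrite {2}N0.
have /choice[e' e'E] := fun j : 'I_N => section_comb (fun k => (k == j)%:R).
have {}e'E j : section_val (e' j) = e j.
  rewrite e'E (bigD1 j) //= eqxx scale1r big1 ?addr0 // => k /negbTE ->.
  by rewrite scale0r.
have e'0 : e' (Ordinal N0) != 0.
  apply/eqP => /(congr1 (fun y : XN => bss_seq X (section_val y) 0%N)).
  have -> : section_val (0 : XN) = 0 by [].
  rewrite e'E coord_e linear0 /canonical_vector eqxx => /eqP.
  by rewrite oner_eq0.
have [A [B [A0 ABC iA qB]]] := opnorm_factors e'0 (qi _) iqC.
have [q' q'E] : exists q' : {linear Z -> X},
    forall z, q' z = of_real s A *: section_val (q z).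
  apply: linear_bundle => c y z; rewrite linearP.
  by rewrite section_val_linear scalerDr !scalerA mulrC.
pose x j : Z := of_real s A^-1 *: i (e' j).
have x_le (a : 'I_N -> R) : rnorm (\sum_j of_real s (a j) *: x j)
    <= rnorm (\sum_j of_real s (a j) *: e j).
  pose y : XN := \sum_j of_real s (a j) *: e' j.
  have -> : \sum_j of_real s (a j) *: e j = section_val y.
    rewrite (@big_morph _ _ (fun y : XN => section_val y) 0 +%R 0 +%R) //.
    by apply: eq_bigr => j _; rewrite -e'E.
  have -> : \sum_j of_real s (a j) *: x j = of_real s A^-1 *: i y.
    rewrite linear_sum scaler_sumr; apply: eq_bigr => j _.
    by rewrite [i (_ *: _)]linearZ_LR /x scalerA [RHS]scalerA mulrC.
  by rewrite rnormZ_real ger0_norm ?invr_ge0 ?(ltW A0) // ler_pdivrMl.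
have q'_le z : rnorm (q' z) <= C * rnorm z.
  rewrite q'E rnormZ_real ger0_norm ?(ltW A0) //.
  apply: le_trans (ler_wpM2l (ltW A0) (qB z)) _.
  by rewrite mulrA ler_wpM2r ?rnorm_ge0.
have q'_x j : q' (x j) = e j.
  have qx : q (x j) = of_real s A^-1 *: e' j by rewrite linearZ_LR qi.
  rewrite q'E qx -[_ *: e' j]addr0 section_val_linear addr0.
  by rewrite scalerA -of_realM divff ?gt_eqF // of_real1 scale1r e'E.
exact: (rnorm_sum_unit_le _ C1 x_le q'_le q'_x).
Qed.
End sections_iso.

(* ['rV[K]_N] carries the sup norm, so it is the N-dimensional l_infty. *)
Theorem proposition2p5 (R : realType) (s : scalar_kind)
    (X : banach_sequence_space R s)
    (d : measure_display) (T : measurableType d)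
    (mu : {measure set T -> \bar R}) :
  uniformly_complemented (fun N => bss_section X N : normedModType (scalar_field R s))
    (Linfty s mu : normedModType (scalar_field R s)) ->
  (ereal_sup [set banach_mazur (bss_section X N : normedModType (scalar_field R s))
     ('rV[scalar_field R s]_N : normedModType (scalar_field R s)) | N in [set: nat]]
     < +oo)%E.
Proof.
move=> [C0 compl]; pose C := Num.max 1 C0.
have /choice[e coord_e] := @canonical_vector_lift R s X.
apply: (@le_lt_trans _ _ (16 * C ^+ 2 * (2 * (16 * C ^+ 2) + 2))%:E); last exact: ltry.
apply: ge_ereal_sup => _ [N _ <-].
have [i [q [_ _ qi iqC]]] := compl N.
apply: (@banach_mazur_section_le _ _ _ _ e) => //.
apply: (@rnorm_sum_le_of_complemented _ _ _ _ _ _ _ _ mu C i q) => //.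
  by rewrite le_max lexx.
by rewrite (le_trans iqC) // lee_fin le_max lexx orbT.
Qed.
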